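(* Let $(x_n)_n$ be a frame for a Hilbert space $H$. Suppose that a finite set of indices $E$ satisfies the minimal redundancy condition for $(x_n)_n$. Then there exists a frame $(v_n)_n$ for $H$ dual to $(x_n)_n$ such that $v_n=0$ for all $n\in E$.
   Context: Convention: $H$ is a complex Hilbert space; sequences $(x_n)_n$ are indexed by a set $J$, where either $J=\mathbb{N}=\{1,2,\ldots\}$ and $H$ is infinite-dimensional and separable, or $J=\{1,\ldots,M\}$ for some $M\in\mathbb N$ and $H$ is finite-dimensional. The sequence $(x_n)_n$ is a frame for $H$ if there are constants $A,B>0$ with $A\|x\|^2\le\sum_{n}|\langle x,x_n\rangle|^2\le B\|x\|^2$ for all $x\in H$. A frame $(v_n)_n$ for $H$ (same index set) is dual to $(x_n)_n$ if $x=\sum_n\langle x,x_n\rangle v_n$ for all $x\in H$. A finite set of indices $E\subseteq J$ satisfies the minimal redundancy condition for $(x_n)_n$ if $\overline{\mathrm{span}}\{x_n: n\in J\setminus E\}=H$. *)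

(* Defs.v *)
From mathcomp Require Import all_boot all_order all_algebra.
From mathcomp Require Import all_classical all_reals all_analysis.
From mathcomp Require Export complex.

Set Implicit Arguments.
Unset Strict Implicit.
Unset Printing Implicit Defensive.

Import Order.TTheory GRing.Theory Num.Theory.
Import numFieldNormedType.Exports.

Local Open Scope classical_set_scope.
Local Open Scope ring_scope.
Local Open Scope complex_scope.

(* MathComp's norm on a module over R[i] takes its (real, nonnegative) values
   in R[i]; Re brings the squared norm back to R. The definition also applies
   to scalars, since R[i] is normed over itself. *)
Definition sqnorm (R : realType) (V : normedZmodType R[i]) (v : V) : R :=
  complex.Re (`|v| ^+ 2).

(* A complex Hilbert space is a complete normed R[i]-module H with an inner
   product dot : {dot H for conjC} (linear on the left, conjugate-linear on the
   right, positive definite) inducing its norm. *)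
Definition inner_product_norm (R : realType) (H : normedModType R[i])
    (dot : {dot H for Num.conj}) : Prop :=
  forall x : H, `|x| ^+ 2 = dot x x.

Definition linear_span (K : numFieldType) (V : lmodType K) (S : set V) : set V :=
  [set v | exists (m : nat) (b : 'I_m -> V) (c : 'I_m -> K),
     (forall i, S (b i)) /\ v = \sum_(i < m) c i *: b i].

Definition finite_dimensional (K : numFieldType) (V : lmodType K) : Prop :=
  exists S : set V, finite_set S /\ linear_span S = setT.

Definition separable (T : topologicalType) : Prop :=
  exists S : set T, countable S /\ dense S.

(* Sequences (x_n) with n in J are functions nat -> H of which only the values
   at indices in J matter. Indices start at 0 rather than 1. *)
Definition index_set (R : realType) (H : normedModType R[i]) (J : set nat) :
    Prop :=
  (J = setT /\ ~ finite_dimensional H /\ separable H) \/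
  (exists M : nat, (0 < M)%N /\ J = `I_M /\ finite_dimensional H).

Definition frame (R : realType) (H : normedModType R[i])
    (dot : {dot H for Num.conj}) (J : set nat) (x : nat -> H) : Prop :=
  exists A B : R, 0 < A /\ 0 < B /\
    forall y : H,
      let S := (\sum_(n <oo | n \in J) (sqnorm (dot y (x n)))%:E)%E in
      ((A * sqnorm y)%:E <= S)%E /\ (S <= (B * sqnorm y)%:E)%E.

Definition dual_frame (R : realType) (H : normedModType R[i])
    (dot : {dot H for Num.conj}) (J : set nat) (x v : nat -> H) : Prop :=
  frame dot J v /\
  forall y : H,
    (fun N : nat => \sum_(0 <= n < N | n \in J) dot y (x n) *: v n) @ \oo --> y.

Definition minimal_redundancy (R : realType) (H : normedModType R[i])
    (J E : set nat) (x : nat -> H) : Prop :=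
  closure (linear_span (x @` (J `\` E))) = setT.

(* Main.v *)
(* Let [S y = \sum_(n in J) <y, x_n> x_n] be the frame operator of a frame with
   bounds [A] and [B].  It is self-adjoint with [A |y|^2 <= <S y, y>] and
   [|S y|^2 <= B <S y, y>], so [u |-> u + (z - S u) / B] is a contraction and
   [S] is onto.

   Deleting one index [k]: let [S w = x_k] and [a = <x_k, w> = <S w, w>].  For
   [a <= c], positivity of the form [q y = <S y, y>] gives
   [|<y, x_k>|^2 <= c q y], so if [c < 1] the remaining vectors satisfy the
   lower frame bound [(1 - c) A].  If [a >= 1], then
   [\sum_(n != k) |<w, x_n>|^2 = a - a^2 <= 0], hence [w] is orthogonal to every
   remaining [x_n] and vanishes by density, contradicting [a >= 1].  Deleting
   the indices of [E] one by one leaves a frame on the complement of [E]; its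
   canonical dual [S^-1 x_n], extended by [0] on [E], is the required dual. *)
Require Import Defs.
From mathcomp Require Import all_boot all_order all_algebra.
From mathcomp Require Import all_classical all_reals all_analysis.
From mathcomp Require Import ring lra.
Import Order.TTheory GRing.Theory Num.Theory numFieldNormedType.Exports.

Local Open Scope classical_set_scope.
Local Open Scope ring_scope.
Local Open Scope complex_scope.

Set Implicit Arguments.
Unset Strict Implicit.
Unset Printing Implicit Defensive.

(** * The norm as a real number *)

Section Nrm.
Variables (R : realType) (V : normedZmodType R[i]).
Implicit Types u v : V.

Definition nrm u : R := complex.Re `|u|.

Lemma nrmE u : `|u| = (nrm u)%:C.
Proof. exact: esym (RRe_real (normr_real u)). Qed.

Lemma nrm_ge0 u : 0 <= nrm u.
Proof. by rewrite -ler0c -nrmE. Qed.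

Lemma sqnormE u : sqnorm u = nrm u ^+ 2.
Proof. by rewrite /sqnorm nrmE -rmorphXn. Qed.

Lemma sqnorm_ge0 u : 0 <= sqnorm u.
Proof. by rewrite sqnormE sqr_ge0. Qed.

Lemma sqnorm0_eq0 u : sqnorm u = 0 -> u = 0.
Proof.
rewrite sqnormE => /eqP; rewrite expf_eq0 /= => /eqP h.
by apply/normr0_eq0; rewrite nrmE h.
Qed.

Lemma ler_nrmD u v : nrm (u + v) <= nrm u + nrm v.
Proof. rewrite -lecR rmorphD /= -!nrmE. exact: ler_normD. Qed.

Lemma nrmN u : nrm (- u) = nrm u.
Proof. by rewrite /nrm normrN. Qed.

End Nrm.

Lemma sqnormCE (R : realType) (z : R[i]) :
  sqnorm z = complex.Re z ^+ 2 + complex.Im z ^+ 2.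
Proof. by rewrite /sqnorm -add_Re2_Im2. Qed.

Lemma conjCE (R : realType) (z : R[i]) :
  Num.conj z = complex.Re z -i* complex.Im z.
Proof. by case: z. Qed.

(** * Limits and fixed points in a complete module *)

Section Convergence.
Variables (R : realType) (H : completeNormedModType R[i]).

Lemma complex_gt0 (e : R[i]) : 0 < e -> exists2 r : R, 0 < r & e = r%:C.
Proof.
move=> e0; exists (complex.Re e); last by rewrite RRe_real// gtr0_real.
by move: e0; rewrite ltcE => /andP[].
Qed.

Lemma nrm_cvg (u : nat -> H) l :
  (fun n => nrm (u n - l)) @ \oo --> (0 : R) -> u @ \oo --> l.
Proof.
move=> h; apply/cvgrPdist_lt => e /complex_gt0[r r0 ->].
move/cvgrPdist_lt : h => /(_ _ r0); apply: filterS => n.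
by rewrite sub0r normrN distrC nrmE ltcR ger0_norm// nrm_ge0.
Qed.

(** Completeness of [H] enters here; comparison with the single term [u N] is enough to make the
    sequence Cauchy. *)
Lemma nrm_cauchy (u : nat -> H) :
  (forall e : R, 0 < e -> exists N, forall n, (N <= n)%N -> nrm (u n - u N) < e) ->
  exists l, (fun n => nrm (u n - l)) @ \oo --> (0 : R).
Proof.
move=> h; have : cvg (u @ \oo).
  apply/cauchy_cvgP/cauchy_exP => e /complex_gt0[r r0 ->].
  have [N hN] := h r r0; exists (u N); exists N => // n /= /hN.
  by rewrite -ball_normE /= distrC nrmE ltcR.
move=> /cvg_ex[l ul]; exists l; apply/cvgrPdist_lt => e e0.
have e0' : 0 < e%:C :> R[i] by rewrite (ltcR 0).
move/cvgrPdist_lt : ul => /(_ _ e0'); apply: filterS => n.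
by rewrite sub0r normrN distrC nrmE ltcR ger0_norm// nrm_ge0.
Qed.

(* The library's [banach_fixed_point] requires real scalars. *)
Lemma nrm_fixpoint (f : H -> H) (q : R) : 0 <= q < 1 ->
  (forall a b, nrm (f a - f b) <= q * nrm (a - b)) -> exists p, f p = p.
Proof.
move=> /andP[q0 q1] fq; pose u n := iter n f 0.
have dist n m : nrm (u (n + m)%N - u n) <= q ^+ n * nrm (u m - u 0%N).
  elim: n => [|n IH]; first by rewrite add0n expr0 mul1r.
  by rewrite addSn (le_trans (fq _ _))// exprS -mulrA ler_wpM2l.
(* [C] is the sum of the geometric series with ratio [q] that starts at the first step; its
   fixed-point equation drives the induction in [bnd]. *)
have [C C0 CE] : exists2 C : R, 0 <= C & C = q * C + nrm (u 1%N - u 0%N).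
  have q1' : 0 < 1 - q by rewrite subr_gt0.
  exists (nrm (u 1%N - u 0%N) / (1 - q)); last by field; rewrite gt_eqF.
  by apply: divr_ge0; [exact: nrm_ge0|exact: ltW].
have bnd m : nrm (u m - u 0%N) <= C.
  elim: m => [|m IH]; first by rewrite subrr /nrm normr0.
  have -> : u m.+1 - u 0%N = (u m.+1 - u 1%N) + (u 1%N - u 0%N).
    by rewrite addrA subrK.
  rewrite (le_trans (ler_nrmD _ _))//.
  by rewrite CE lerD2r (le_trans (fq _ _))// ler_wpM2l.
have qC : (fun n => q ^+ n * C) @ \oo --> (0 : R).
  rewrite -[0](mul0r C); apply: cvgMl; apply: cvg_expr.
  by rewrite ger0_norm.
have [l ul] : exists l, (fun n => nrm (u n - l)) @ \oo --> (0 : R).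
  apply: nrm_cauchy => e e0.
  move/cvgrPdist_lt : (qC) => /(_ _ e0)[N _ /(_ N (leqnn N))] /=.
  rewrite sub0r normrN ger0_norm ?mulr_ge0 ?exprn_ge0// => hN.
  exists N => n /subnKC <-; rewrite (le_lt_trans _ hN)//.
  by rewrite (le_trans (dist _ _))// ler_wpM2l ?exprn_ge0.
exists l; apply/eqP; rewrite -subr_eq0; apply/eqP/sqnorm0_eq0.
rewrite sqnormE; apply/eqP; rewrite expf_eq0 /= eq_le nrm_ge0 andbT.
(* This sequence dominates the constant [nrm (f l - l)] and tends to zero. *)
have h : (fun n => q * nrm (u n - l) + nrm (u n.+1 - l)) @ \oo --> q * 0 + 0.
  apply: cvgD; first exact: cvgMr.
  by rewrite (cvg_shiftS (fun n => nrm (u n - l))).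
have -> : 0 = q * 0 + 0 by rewrite mulr0 addr0.
apply: (cvgr_to_ge h); apply: nearW => n.
have -> : f l - l = (f l - u n.+1) + (u n.+1 - l) by rewrite addrA subrK.
rewrite (le_trans (ler_nrmD _ _))// lerD2r -(nrmN (u n - l)) opprB.
exact: fq.
Qed.

End Convergence.

(** * Real part of the inner product, Cauchy-Schwarz and Bessel bounds *)

Section InnerProduct.
Variables (R : realType) (H : completeNormedModType R[i]).
Variables (dot : {dot H for Num.conj}) (hdot : inner_product_norm dot).
Implicit Types u v w z : H.

Definition re_dot u v : R := complex.Re (dot u v).
Local Notation rdot := re_dot.

Lemma dotDl u v w : dot (u + v) w = dot u w + dot v w.
Proof. exact: linearDl. Qed.

Lemma dotZl (c : R[i]) u w : dot (c *: u) w = c * dot u w.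
Proof. exact: linearZl_LR. Qed.

Lemma dotDr u v w : dot w (u + v) = dot w u + dot w v.
Proof. exact: linearDr. Qed.

Lemma dotZr (c : R[i]) u w : dot w (c *: u) = Num.conj c * dot w u.
Proof. exact: linearZr_LR. Qed.

Lemma dotC u v : dot u v = Num.conj (dot v u).
Proof. by rewrite hermC /= expr0 mul1r. Qed.

Lemma dot_suml (I : Type) (r : seq I) (P : pred I) (F : I -> H) w :
  dot (\sum_(i <- r | P i) F i) w = \sum_(i <- r | P i) dot (F i) w.
Proof. exact: linear_sumlz. Qed.

Lemma dot_sumr (I : Type) (r : seq I) (P : pred I) (F : I -> H) w :
  dot w (\sum_(i <- r | P i) F i) = \sum_(i <- r | P i) dot w (F i).
Proof. exact: linear_sumr. Qed.

Lemma dotNl u w : dot (- u) w = - dot u w.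
Proof. exact: linearNl. Qed.

Lemma dot0l w : dot 0 w = 0.
Proof. exact: linear0l. Qed.

Lemma dotvv u : dot u u = (sqnorm u)%:C.
Proof. by rewrite -hdot /sqnorm nrmE -rmorphXn. Qed.

Lemma rdotvv u : rdot u u = sqnorm u.
Proof. by rewrite /re_dot dotvv. Qed.

Lemma rdotC u v : rdot u v = rdot v u.
Proof. by rewrite /re_dot dotC conjCE. Qed.

Lemma rdotDl u v w : rdot (u + v) w = rdot u w + rdot v w.
Proof. by rewrite /re_dot dotDl; case: (dot u w); case: (dot v w). Qed.

Lemma rdot_suml (I : Type) (r : seq I) (P : pred I) (F : I -> H) w :
  rdot (\sum_(i <- r | P i) F i) w = \sum_(i <- r | P i) rdot (F i) w.
Proof.
apply: (big_morph (fun u => rdot u w)) => [u v|]; first exact: rdotDl.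
by rewrite /re_dot dot0l.
Qed.

Lemma rdotNl u w : rdot (- u) w = - rdot u w.
Proof. by rewrite /re_dot dotNl; case: (dot u w). Qed.

Lemma rdotBl u v w : rdot (u - v) w = rdot u w - rdot v w.
Proof. by rewrite rdotDl rdotNl. Qed.

Lemma rdotZl (t : R) u w : rdot (t%:C *: u) w = t * rdot u w.
Proof. by rewrite /re_dot dotZl; case: (dot u w) => a b /=; rewrite mul0r subr0. Qed.

Lemma rdotDr u v w : rdot w (u + v) = rdot w u + rdot w v.
Proof. by rewrite rdotC rdotDl !(rdotC w). Qed.

Lemma sqnormDZ (t : R) u v :
  sqnorm (u + t%:C *: v) = sqnorm u + 2 * t * rdot u v + t ^+ 2 * sqnorm v.
Proof.
rewrite -!rdotvv rdotDl !rdotDr (rdotC u (_ *: _)) !rdotZl.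
by rewrite (rdotC v (_ *: _)) rdotZl (rdotC v u); ring.
Qed.

Lemma sqnormB u v : sqnorm (u - v) = sqnorm u - 2 * rdot u v + sqnorm v.
Proof.
have -> : u - v = u + (-1 : R)%:C *: v by rewrite rmorphN1 scaleN1r.
by rewrite sqnormDZ; ring.
Qed.

Lemma rdot_le u v : `|rdot u v| <= nrm u * nrm v.
Proof.
rewrite -ler_sqr ?nnegrE ?mulr_ge0 ?nrm_ge0// exprMn -!sqnormE -normrX.
rewrite ger0_norm ?sqr_ge0//.
have [->|/eqP v0] := pselect (v = 0).
  by rewrite rdotC /re_dot dot0l /= expr0n /=; apply: mulr_ge0; exact: sqnorm_ge0.
have sv : 0 < sqnorm v.
  by rewrite lt_neqAle sqnorm_ge0 andbT eq_sym; apply: contra v0 => /eqP/sqnorm0_eq0 ->.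
(* Cauchy-Schwarz: subtract from [u] its real projection on [v], then clear the denominator
   [sqnorm v]. *)
have := mulr_ge0 (sqnorm_ge0 (u + (- (rdot u v / sqnorm v))%:C *: v)) (ltW sv).
rewrite sqnormDZ.
set s := sqnorm v in sv *; set r := rdot u v; set t := sqnorm u.
suff -> : (t + 2 * - (r / s) * r + (- (r / s)) ^+ 2 * s) * s = t * s - r ^+ 2.
  by rewrite subr_ge0.
by field; rewrite gt_eqF.
Qed.

Lemma eq_rdot u v : (forall w, rdot u w = rdot v w) -> u = v.
Proof.
move=> h; apply/eqP; rewrite -subr_eq0; apply/eqP/sqnorm0_eq0.
by rewrite -rdotvv rdotBl h subrr.
Qed.

(* Norm convergence phrased in [R], since the norm of [H] takes values in [R[i]]. *)
Definition hcvg (u : nat -> H) l := (fun n => nrm (u n - l)) @ \oo --> (0 : R).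

Lemma hcvg_rdot (u : nat -> H) l w : hcvg u l ->
  (fun n => rdot (u n) w) @ \oo --> rdot l w.
Proof.
move=> ul; apply/cvgrPdistC_lt => e e0.
(* Adding 1 keeps the divisor positive when [w = 0]. *)
have w1 : 0 < nrm w + 1 by rewrite ltr_wpDl ?nrm_ge0.
have ew : 0 < e / (nrm w + 1) by rewrite divr_gt0.
move/cvgrPdist_lt : ul => /(_ _ ew); apply: filterS => n.
rewrite sub0r normrN ger0_norm ?nrm_ge0// ltr_pdivlMr// => hn.
rewrite -rdotBl (le_lt_trans (rdot_le _ _))// (le_lt_trans _ hn)//.
by rewrite ler_wpM2l ?nrm_ge0// lerDl.
Qed.

Lemma hcvg_sqnorm (u : nat -> H) l : hcvg u l ->
  (fun n => sqnorm (u n)) @ \oo --> sqnorm l.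
Proof.
move=> ul.
(* Expanding |u_n - l|^2 expresses |u_n|^2 through quantities whose limits are known. *)
have h : (fun n => nrm (u n - l) * nrm (u n - l) + 2 * rdot (u n) l - sqnorm l)
    @ \oo --> 0 * 0 + 2 * rdot l l - sqnorm l.
  apply: cvgB; last exact: cvg_cst.
  apply: cvgD; first exact: cvgM.
  by apply: cvgMr; apply: hcvg_rdot.
have E : 0 * 0 + 2 * rdot l l - sqnorm l = sqnorm l by rewrite rdotvv; ring.
rewrite E in h; apply: cvg_trans h.
apply: near_eq_cvg; apply: nearW => n.
by rewrite -expr2 -sqnormE sqnormB; ring.
Qed.

(** The synthesis map is the adjoint of the analysis map [u |-> (dot u (x i))_i] and inherits its
    bound [B]. *)
Lemma bessel_dual (I : Type) (r : seq I) (P : pred I) (c : I -> R[i])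
    (x : I -> H) (B : R) : 0 < B ->
  (forall u, \sum_(i <- r | P i) sqnorm (dot u (x i)) <= B * sqnorm u) ->
  sqnorm (\sum_(i <- r | P i) c i *: x i) <= B * \sum_(i <- r | P i) sqnorm (c i).
Proof.
move=> B0 hB; set u := \sum_(i <- r | P i) _.
(* Expanding this sum of squares replaces Cauchy-Schwarz for finite sums. *)
have : 0 <= \sum_(i <- r | P i) sqnorm (B%:C * c i - dot u (x i)).
  by apply: sumr_ge0 => i _; exact: sqnorm_ge0.
have E i : sqnorm (B%:C * c i - dot u (x i)) = B ^+ 2 * sqnorm (c i)
   - 2 * B * rdot (c i *: x i) u + sqnorm (dot u (x i)).
  rewrite /re_dot dotZl (dotC (x i)) conjCE !sqnormCE.
  by case: (c i) (dot u (x i)) => a b [a' b'] /=; ring.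
rewrite (eq_bigr _ (fun i _ => E i)) big_split sumrB -!mulr_sumr.
rewrite -rdot_suml rdotvv -/u.
move: (hB u); set s := sqnorm u.
set p := \sum_(i <- r | P i) sqnorm (dot u (x i)).
set q := \sum_(i <- r | P i) sqnorm (c i) => h1 /= h2.
(* From 0 <= B^2 q - 2 B s + p and p <= B s follows B s <= B^2 q. *)
by rewrite -(ler_pM2l B0); nra.
Qed.

End InnerProduct.

(** * Frame bounds and the frame operator *)

Section FrameOperator.
Variables (R : realType) (H : completeNormedModType R[i]).
Variables (dot : {dot H for Num.conj}) (hdot : inner_product_norm dot).
Implicit Types (u v w y z : H) (J : set nat) (x : nat -> H).
Local Notation rdot := (re_dot dot).

Definition coef_sum J x N y : R :=
  \sum_(0 <= n < N | n \in J) sqnorm (dot y (x n)).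

Definition frame_sum J x N y : H :=
  \sum_(0 <= n < N | n \in J) dot y (x n) *: x n.

(** The series is given by a limit in [R] rather than an extended real sum; [frameP] relates the two
    forms. *)
Definition frame_bounds J x (A B : R) := forall y, exists s : R,
  (fun N => coef_sum J x N y) @ \oo --> s /\
  A * sqnorm y <= s <= B * sqnorm y.

Lemma coef_sum_nd J x y : nondecreasing_seq (fun N => coef_sum J x N y).
Proof.
apply/nondecreasing_seqP => n; rewrite /coef_sum big_mkcond [leRHS]big_mkcond.
rewrite big_nat_recr//= lerDl.
by case: ifP => // _; exact: sqnorm_ge0.
Qed.

Lemma coef_sum_le_lim J x N y (s : R) :
  (fun N => coef_sum J x N y) @ \oo --> s -> coef_sum J x N y <= s.
Proof.
move=> cs; rewrite -(cvg_lim _ cs)//.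
apply: (@nondecreasing_cvgn_le _ (fun N => coef_sum J x N y)).
  exact: coef_sum_nd.
exact: cvgP cs.
Qed.

Lemma eseries_coef_sum J x y (s : R) : (fun N => coef_sum J x N y) @ \oo --> s ->
  (\sum_(n <oo | n \in J) (sqnorm (dot y (x n)))%:E)%E = s%:E.
Proof.
move=> cs; rewrite -(cvg_lim _ cs)// -EFin_lim; last exact: cvgP cs.
by congr (limn _); apply: funext => N /=; rewrite sumEFin.
Qed.

Lemma frameP J x : frame dot J x <->
  exists A B : R, [/\ 0 < A, 0 < B & frame_bounds J x A B].
Proof.
split=> [[A [B [A0 [B0 h]]]]|[A [B [A0 B0 h]]]]; last first.
  exists A, B; split=> //; split=> // y.
  have [s [cs /andP[h1 h2]]] := h y.
  by rewrite /= (eseries_coef_sum cs) !lee_fin.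
exists A, B; split=> // y; have [h1 h2] := h y.
have cs : cvgn (fun N => coef_sum J x N y).
  apply: nondecreasing_is_cvgn; first exact: coef_sum_nd.
  exists (B * sqnorm y) => _ [N _ <-]; rewrite -lee_fin (le_trans _ h2)//.
  rewrite /coef_sum -sumEFin; apply: nneseries_lim_ge => n _ _.
  by rewrite lee_fin sqnorm_ge0.
exists (limn (fun N => coef_sum J x N y)); split=> //.
by move: h1 h2; rewrite /= (eseries_coef_sum cs) !lee_fin => -> ->.
Qed.

Lemma coef_sum_le J x A B N y : frame_bounds J x A B ->
  coef_sum J x N y <= B * sqnorm y.
Proof.
by move=> /(_ y)[s [cs /andP[_]]]; apply: le_trans; exact: coef_sum_le_lim cs.
Qed.

Lemma dot_frame_sum J x N y z : dot (frame_sum J x N y) z = dot y (frame_sum J x N z).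
Proof.
rewrite /frame_sum dot_suml dot_sumr; apply: eq_bigr => n _.
by rewrite dotZl dotZr -dotC mulrC.
Qed.

Lemma rdot_frame_sum J x N y : rdot (frame_sum J x N y) y = coef_sum J x N y.
Proof.
rewrite /frame_sum rdot_suml; apply: eq_bigr => n _.
rewrite /re_dot dotZl (dotC _ (x n)) conjCE sqnormCE.
by case: (dot y (x n)) => a b /=; ring.
Qed.

(** The difference is the synthesis of the coefficients with index in [M, N), and this block
    satisfies the Bessel bound of the whole family. *)
Lemma sqnorm_frame_sum J x A B M N y : 0 < B -> frame_bounds J x A B ->
  (M <= N)%N ->
  sqnorm (frame_sum J x N y - frame_sum J x M y) <=
  B * (coef_sum J x N y - coef_sum J x M y).
Proof.
move=> B0 fb MN.
have split_sum (V : nmodType) (F : nat -> V) : \sum_(0 <= n < N | n \in J) F n =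
    \sum_(0 <= n < M | n \in J) F n + \sum_(M <= n < N | n \in J) F n.
  by rewrite (big_cat_nat (leq0n M) MN).
rewrite /frame_sum /coef_sum !split_sum (addrC (\sum_(0 <= n < M | n \in J) _)) addrK.
rewrite (addrC (\sum_(0 <= n < M | n \in J) _)) addrK.
apply: bessel_dual => // u; apply: le_trans (coef_sum_le N u fb).
rewrite /coef_sum split_sum lerDr; apply: sumr_ge0 => i _; exact: sqnorm_ge0.
Qed.

Lemma frame_sum_cvg J x A B y : 0 < B -> frame_bounds J x A B ->
  exists l, hcvg (fun N => frame_sum J x N y) l.
Proof.
move=> B0 fb; apply: nrm_cauchy => e e0.
have [s [cs _]] := fb y.
(* A coefficient tail below e^2 / B forces the squared norm of the vector tail below e^2. *)
have e2 : 0 < e ^+ 2 / B by rewrite divr_gt0// exprn_gt0.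
move/cvgrPdist_lt : (cs) => /(_ _ e2)[N _ /(_ N (leqnn N))] /= hN.
exists N => n Nn; rewrite -ltr_sqr ?nnegrE ?nrm_ge0 ?ltW// -sqnormE.
apply: le_lt_trans (sqnorm_frame_sum y B0 fb Nn) _.
rewrite mulrC -ltr_pdivlMr// (le_lt_trans _ hN)// (le_trans _ (ler_norm _))//.
by rewrite lerD2r; exact: coef_sum_le_lim cs.
Qed.

(** Carries the symmetry of the partial sums over to their limits. Continuity is available for real
    parts, so imaginary parts are first turned into real ones. *)
Lemma hcvg_dot_eq (a b : nat -> H) l m y z : hcvg a l -> hcvg b m ->
  (forall n, dot (a n) z = dot y (b n)) -> dot l z = dot y m.
Proof.
have Re_eq (a' b' : nat -> H) l' m' y' z' : hcvg a' l' -> hcvg b' m' ->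
    (forall n, dot (a' n) z' = dot y' (b' n)) -> rdot l' z' = rdot y' m'.
  move=> al bm ab.
  have h1 := hcvg_rdot (w := z') hdot al; have h2 := hcvg_rdot (w := y') hdot bm.
  have E : (fun n => rdot (a' n) z') = (fun n => rdot (b' n) y').
    by apply: funext => n; rewrite [RHS]rdotC /re_dot ab.
  by rewrite [RHS]rdotC -(cvg_lim _ h2)// -E (cvg_lim _ h1).
move=> al bm ab; apply/eqP; rewrite eq_complex.
(* Im <p, r> = Re <-i p, r>. *)
have iE (p r : H) : complex.Im (dot p r) = rdot ((- 'i) *: p) r.
  by rewrite /re_dot dotZl; case: (dot p r) => c d /=; ring.
have ai : hcvg (fun n => (- 'i) *: a n) ((- 'i) *: l).
  rewrite /hcvg; under eq_fun do rewrite -scalerBr.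
  by under eq_fun do rewrite /nrm normrZ normrN normc_def /= expr0n expr1n add0r sqrtr1 mul1r.
apply/andP; split; apply/eqP; first exact: (Re_eq a b).
rewrite !iE; apply: Re_eq ai bm _ => n.
by rewrite !dotZl ab.
Qed.

(** Linearity is not a field: it is derived from [frame_op_adj]. The last field is the estimate
    behind the contraction argument. *)
Record frame_operator J x (A B : R) (S : H -> H) : Prop := FrameOperator {
  frame_op_cvg : forall y, hcvg (fun N => frame_sum J x N y) (S y);
  frame_op_adj : forall y z, dot (S y) z = dot y (S z);
  frame_op_coef : forall y, (fun N => coef_sum J x N y) @ \oo --> rdot (S y) y;
  frame_op_lower : forall y, A * sqnorm y <= rdot (S y) y;
  frame_op_upper : forall y, sqnorm (S y) <= B * rdot (S y) y }.

Lemma frame_operator_exists J x A B : 0 < B -> frame_bounds J x A B ->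
  exists S, frame_operator J x A B S.
Proof.
move=> B0 fb.
have [S hS] := choice (fun y => frame_sum_cvg y B0 fb).
have coefS y : (fun N => coef_sum J x N y) @ \oo --> rdot (S y) y.
  have := hcvg_rdot (w := y) hdot (hS y).
  by under eq_fun do rewrite rdot_frame_sum.
exists S; split=> // [y z|y|y].
- exact: hcvg_dot_eq (hS y) (hS z) (fun n => dot_frame_sum J x n y z).
- by have [s [cs /andP[h _]]] := fb y; rewrite -(cvg_lim _ (coefS y))// (cvg_lim _ cs).
(* The block estimate with lower end 0 passes to the limit. *)
- apply: (ler_cvg_to (hcvg_sqnorm hdot (hS y)) (cvgMr (coefS y))).
  apply: nearW => N; have := sqnorm_frame_sum y B0 fb (leq0n N).
  by rewrite /frame_sum /coef_sum !(big_geq (leqnn 0)) !subr0.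
Qed.

(** * Linearity and surjectivity of the frame operator *)

Section OperatorTheory.
Variables (J : set nat) (x : nat -> H) (A B : R) (S : H -> H).
Hypotheses (A0 : 0 < A) (B0 : 0 < B) (fS : frame_operator J x A B S).

(** Adjointness moves [S] to the right argument, leaving the linear left one free. *)
Lemma frame_op_linear (c : R[i]) y z : S (c *: y + z) = c *: S y + S z.
Proof.
apply: (eq_rdot hdot) => w.
by rewrite /re_dot (frame_op_adj fS) !dotDl !dotZl !(frame_op_adj fS).
Qed.

Lemma frame_opB y z : S (y - z) = S y - S z.
Proof. by rewrite addrC -scaleN1r frame_op_linear scaleN1r addrC. Qed.

Lemma frame_op_surj z : exists u, S u = z.
Proof.
(* [f] is a contraction: [|d - S d / B|^2 <= (1 - A / B) |d|^2]. *)
pose f u := u + (B^-1)%:C *: (z - S u).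
(* [A <= B] can fail when [H] is trivial, whence the maximum. *)
pose t := Num.max 0 (1 - A / B).
have t0 : 0 <= t by rewrite le_max lexx.
have t1 : t < 1 by rewrite gt_max ltr01 gtrBl divr_gt0.
(* The contraction estimate is on squared norms, so the ratio is the square root of [t]. *)
have [|a b|p] := @nrm_fixpoint _ _ f (Num.sqrt t).
- by rewrite sqrtr_ge0 -sqrtr1 ltr_sqrt.
- rewrite -ler_sqr ?nnegrE ?mulr_ge0 ?sqrtr_ge0 ?nrm_ge0// exprMn sqr_sqrtr//.
  rewrite -!sqnormE.
  have -> : f a - f b = (a - b) + (- B^-1)%:C *: S (a - b).
    rewrite frame_opB /f opprD addrACA -scalerBr rmorphN scaleNr -scalerN.
    by congr (_ + _ *: _); rewrite !opprB addrC addrA subrK.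
  set d := a - b; rewrite (sqnormDZ hdot) [rdot d _]rdotC.
  apply: (@le_trans _ _ ((1 - A / B) * sqnorm d)); last first.
    by rewrite ler_wpM2r ?sqnorm_ge0// le_max lexx orbT.
  have h1 := frame_op_lower fS d; have h2 := frame_op_upper fS d.
  have Bi : 0 < B^-1 by rewrite invr_gt0.
  have BB : B^-1 * B = 1 by rewrite mulVf// gt_eqF.
  have h3 := ler_wpM2l (ltW Bi) h1.
  (* Since B^-2 |S d|^2 <= B^-1 <S d, d>, half of the cross term survives, and it is at least (A /
     B) |d|^2. *)
  have h4 := ler_wpM2l (ltW (exprn_gt0 2 Bi)) h2.
  have E : B^-1 ^+ 2 * (B * rdot (S d) d) = B^-1 * rdot (S d) d.
    by rewrite expr2 -mulrA [B^-1 * (B * _)]mulrA BB mul1r.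
  rewrite E in h4; lra.
move=> /eqP; rewrite /f -subr_eq0 addrAC subrr add0r scaler_eq0.
rewrite (_ : (B^-1)%:C == 0 = false) /=; last first.
  by rewrite eq_complex /= eqxx andbT invr_eq0 gt_eqF.
by rewrite subr_eq0 => /eqP ->; exists p.
Qed.

End OperatorTheory.

End FrameOperator.

(** * Deleting redundant indices and the dual frame *)

Section Redundancy.
Variables (R : realType) (H : completeNormedModType R[i]).
Variables (dot : {dot H for Num.conj}) (hdot : inner_product_norm dot).
Implicit Types (u v w y z : H) (J E : set nat) (x : nat -> H).
Local Notation rdot := (re_dot dot).

Lemma coef_sum_setD1 J x k N y : J k -> (k < N)%N ->
  coef_sum dot (J `\ k) x N y = coef_sum dot J x N y - sqnorm (dot y (x k)).
Proof.
move=> Jk kN; rewrite /coef_sum !big_mkord.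
rewrite [in RHS](bigD1 (Ordinal kN)) /=; last exact: mem_set.
rewrite addrC addrK; apply: eq_bigl => i.
apply/idP/andP => [/set_mem[Ji ik]|[/set_mem Ji ik]].
  by split; [exact: mem_set|apply/eqP => ie; apply: ik; rewrite ie].
by apply/mem_set; split => // ie; move/eqP : ik; apply; exact: val_inj.
Qed.

Lemma coef_sum_eq0 J x y n : (forall N, coef_sum dot J x N y <= 0) -> J n ->
  dot y (x n) = 0.
Proof.
move=> h Jn; apply: sqnorm0_eq0; apply/eqP; rewrite eq_le sqnorm_ge0 andbT.
(* Index [n] is the last one in the partial sum of length [n.+1]; all other terms are
   nonnegative. *)
apply: le_trans (h n.+1); rewrite /coef_sum big_mkcond big_nat_recr//=.
rewrite mem_set// lerDr; apply: sumr_ge0 => i _.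
by case: ifP => // _; exact: sqnorm_ge0.
Qed.

Lemma frame_bounds_setD1 J x (A B : R) k : 0 < A -> 0 < B ->
  frame_bounds dot J x A B -> J k ->
  (forall w, (forall n, (J `\ k) n -> dot w (x n) = 0) -> w = 0) ->
  exists2 A' : R, 0 < A' & frame_bounds dot (J `\ k) x A' B.
Proof.
move=> A0 B0 fb Jk total.
have [S fS] := frame_operator_exists hdot B0 fb.
have [w Sw] := frame_op_surj hdot A0 B0 fS (x k).
pose q y := rdot (S y) y; pose m y := sqnorm (dot y (x k)).
have q_ge0 y : 0 <= q y.
  by apply: le_trans (frame_op_lower fS y); rewrite mulr_ge0 ?sqnorm_ge0// ltW.
have cvg' y : (fun N => coef_sum dot (J `\ k) x N y) @ \oo --> q y - m y.
  have h : (fun N => coef_sum dot J x N y - m y) @ \oo --> q y - m y.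
    by apply: cvgB; [exact: (frame_op_coef fS (y := y))|exact: cvg_cst].
  apply: cvg_trans h.
  apply: near_eq_cvg; exists k.+1 => // N /= kN.
  by rewrite coef_sum_setD1.
have le' N y : coef_sum dot (J `\ k) x N y <= q y - m y.
  exact: coef_sum_le_lim (cvg' y).
set a := q w.
(* As [x k = S w], self-adjointness makes this number equal to its conjugate. *)
have dSw : dot (x k) w = a%:C.
  rewrite /a /q /re_dot Sw.
  have : dot (x k) w = Num.conj (dot (x k) w) by rewrite -dotC -Sw (frame_op_adj fS).
  by rewrite conjCE; case: (dot (x k) w) => b c [] /= cE; congr (_ +i* _); lra.
have mw : m w = a ^+ 2.
  by rewrite /m dotC dSw conjCE sqnormCE /=; ring.
have a0 : 0 <= a := q_ge0 w.
have a1 : a < 1.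
  rewrite ltNge; apply/negP => a1.
  have w0 : w = 0.
    apply: total => n; apply: coef_sum_eq0 => N; apply: le_trans (le' N w) _.
    by rewrite mw -/a; nra.
  by move: a1; rewrite /a /q w0 rdotC /re_dot dot0l /= ler10.
(* The midpoint of [a] and 1 is below 1, and positive even when [a = 0], so it can be inverted. *)
pose c := (1 + a) / 2.
have c0 : 0 < c by rewrite /c; lra.
have c1 : c < 1 by rewrite /c; lra.
have ac : a <= c by rewrite /c; lra.
have mc y : m y <= c * q y.
  set p := dot y (x k).
  (* Positivity of the form [q] at [y - (p / c) w]. *)
  have := q_ge0 ((- (c^-1%:C * p)) *: w + y).
  have -> : q ((- (c^-1%:C * p)) *: w + y) = q y - 2 * c^-1 * m y + c^-1 ^+ 2 * a * m y.
    rewrite /q /re_dot (frame_op_linear hdot fS) Sw !dotDl !dotDr !dotZl !dotZr.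
    rewrite dSw (frame_op_adj fS y w) Sw -/p [dot (x k) y]dotC -/p /m -/p !conjCE sqnormCE.
    by case: p => p1 p2; case: (dot (S y) y) => q1 q2 /=; ring.
  have ci : 0 < c^-1 by rewrite invr_gt0.
  have cc : c^-1 * c = 1 by rewrite mulVf// gt_eqF.
  have m0 : 0 <= m y by exact: sqnorm_ge0.
  move=> h.
  (* By a <= c the quadratic term is at most c^-1 m, so the expansion yields 0 <= q - c^-1 m. *)
  have h1 := ler_wpM2r m0 (ler_wpM2l (ltW ci) (ler_wpM2l (ltW ci) ac)).
  rewrite cc mulr1 in h1.
  have h2 : c^-1 * m y <= q y by lra.
  by have := ler_wpM2l (ltW c0) h2; rewrite mulrA mulfV ?mul1r// gt_eqF.
exists ((1 - c) * A); first by rewrite mulr_gt0// subr_gt0.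
move=> y; exists (q y - m y); split; first exact: cvg'.
apply/andP; split.
  have h1 := frame_op_lower fS y; have h2 := mc y.
  have c1' : 0 <= 1 - c by rewrite subr_ge0 ltW.
  by have := ler_wpM2l c1' h1; rewrite /q in h2 *; lra.
apply: (@le_trans _ _ (q y)); first by rewrite gerBl sqnorm_ge0.
have h : (fun N => coef_sum dot J x N y) @ \oo --> q y by exact: (frame_op_coef fS (y := y)).
by apply: (cvgr_to_le h); apply: nearW => N; exact: coef_sum_le fb.
Qed.

Lemma frame_bounds_setD J x (A B : R) (s : seq nat) : 0 < A -> 0 < B ->
  frame_bounds dot J x A B ->
  (forall w, (forall n, (J `\` [set` s]) n -> dot w (x n) = 0) -> w = 0) ->
  exists2 A' : R, 0 < A' & frame_bounds dot (J `\` [set` s]) x A' B.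
Proof.
move=> A0 B0 fb; elim: s => [|k s IH] total.
  by rewrite set_nil setD0; exists A.
have [|A1 A10 fb1] := IH.
  (* A vector orthogonal to the larger family left by [s] is orthogonal to the one left by
     [k :: s]. *)
  move=> w hw; apply: total => n [Jn /= kns]; apply: hw; split => //= ns.
  by apply: kns; rewrite /= inE ns orbT.
have E : J `\` [set` k :: s] = (J `\` [set` s]) `\ k.
  by rewrite setDDl setUC; congr (_ `\` _); apply/seteqP; split=> n /=; rewrite inE => /predU1P.
rewrite E in total *.
(* If [k] is outside [J] or already deleted, the family does not change. *)
have [Jk|nJk] := pselect ((J `\` [set` s]) k).
  exact: (frame_bounds_setD1 A10 B0 fb1).
have -> : (J `\` [set` s]) `\ k = J `\` [set` s].
  by apply/seteqP; split => n [] // h1 h2; split => //= nk; apply: nJk; rewrite -nk.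
by exists A1.
Qed.

(** A vector [v'] of the span within [e] of [w] is orthogonal to [w], so by Pythagoras |w| <= |w -
    v'| < e. *)
Lemma minimal_redundancy_total J E x : minimal_redundancy J E x ->
  forall w, (forall n, (J `\` E) n -> dot w (x n) = 0) -> w = 0.
Proof.
move=> hmin w hw; apply: sqnorm0_eq0; apply/eqP; rewrite sqnormE sqrf_eq0.
rewrite eq_le nrm_ge0 andbT; apply/ler_addgt0Pl => e e0; rewrite addr0.
have : closure (linear_span (x @` (J `\` E))) w by rewrite hmin.
have e0' : 0 < e%:C :> R[i] by rewrite (ltcR 0).
move=> /(_ _ (nbhsx_ballx w _ e0'))[v [[M [b [c [hb ->]]]]]].
rewrite -ball_normE /= nrmE ltcR => /ltW; apply: le_trans.
set v' := \sum_(_ < _) _.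
have wv : rdot w v' = 0.
  rewrite /re_dot dot_sumr big1// => i _; have [n Jn <-] := hb i.
  by rewrite dotZr hw// mulr0.
rewrite -ler_sqr ?nnegrE ?nrm_ge0// -!sqnormE (sqnormB hdot) wv mulr0 subr0.
by rewrite lerDl sqnorm_ge0.
Qed.

(** With [T] inverse to [S], put v_n = T x_n on [J] and 0 elsewhere. The reconstruction sums are [T]
    applied to the frame sums, hence tend to T (S y) = y. *)
Lemma frame_dual J F x : J `<=` F -> frame dot J x ->
  exists v : nat -> H,
    dual_frame dot F x v /\ (forall n : nat, ~ J n -> v n = 0).
Proof.
move=> JF /(frameP dot)[A [B [A0 B0 fb]]].
have [S fS] := frame_operator_exists hdot B0 fb.
have [T ST] := choice (frame_op_surj hdot A0 B0 fS).
(* Divide A |u|^2 <= <S u, u> <= |S u| |u| by |u|, unless it is zero. *)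
have lower u : A * nrm u <= nrm (S u).
  have [->|u0] := eqVneq (nrm u) 0; first by rewrite mulr0 nrm_ge0.
  have u0' : 0 < nrm u by rewrite lt_neqAle eq_sym u0 nrm_ge0.
  rewrite -(ler_pM2r u0') -mulrA -expr2 -sqnormE (le_trans (frame_op_lower fS u))//.
  exact: le_trans (ler_norm _) (rdot_le hdot _ _).
have S_inj u v : S u = S v -> u = v.
  move=> uv; apply/eqP; rewrite -subr_eq0; apply/eqP/sqnorm0_eq0.
  rewrite sqnormE; apply/eqP; rewrite sqrf_eq0 eq_le nrm_ge0 andbT.
  rewrite -(ler_pM2l A0) mulr0 (le_trans (lower _))//.
  by rewrite (frame_opB hdot fS) uv subrr /nrm normr0.
have TS u : T (S u) = u by apply: S_inj; rewrite ST.
have dotT y z : dot y (T z) = dot (T y) z.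
  by rewrite -{1}(ST y) (frame_op_adj fS) ST.
have Tlin (c : R[i]) y z : T (c *: y + z) = c *: T y + T z.
  by apply: S_inj; rewrite (frame_op_linear hdot fS) !ST.
have TD y z : T (y + z) = T y + T z by rewrite -[y]scale1r Tlin !scale1r.
have T0 : T 0 = 0 by apply: (addrI (T 0)); rewrite -TD !addr0.
have TZ (c : R[i]) y : T (c *: y) = c *: T y.
  by rewrite -[c *: y]addr0 Tlin T0 addr0.
have TB y z : T (y - z) = T y - T z by rewrite -scaleN1r TD TZ scaleN1r.
have T_le z : A * nrm (T z) <= nrm z by rewrite -{2}(ST z).
(* Here |z|^2 = |S (T z)|^2 <= B <z, T z> <= B |z| |T z|. *)
have T_ge z : nrm z <= B * nrm (T z).
  have [->|z0] := eqVneq (nrm z) 0; first by rewrite mulr_ge0 ?nrm_ge0// ltW.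
  have z0' : 0 < nrm z by rewrite lt_neqAle eq_sym z0 nrm_ge0.
  rewrite -(ler_pM2l z0') mulrCA -expr2 -sqnormE -{1}(ST z).
  rewrite (le_trans (frame_op_upper fS (T z)))// ST ler_pM2l//.
  exact: le_trans (ler_norm _) (rdot_le hdot _ _).
pose v n : H := if n \in J then T (x n) else 0.
have JF' n : n \in J -> n \in F by move=> /set_mem/JF/mem_set.
have coef_v N y : coef_sum dot F v N y = coef_sum dot J x N (T y).
  rewrite /coef_sum big_mkcond [RHS]big_mkcond; apply: eq_bigr => n _.
  rewrite /v; case: ifPn => nF.
    case: ifPn => nJ; first by rewrite dotT.
    by rewrite dotC dot0l conjC0 /sqnorm normr0 expr0n.
  by case: ifPn => // /JF'; rewrite (negbTE nF).
have sum_v N y :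
    \sum_(0 <= n < N | n \in F) dot y (x n) *: v n = T (frame_sum dot J x N y).
  rewrite /frame_sum (big_morph T TD T0) big_mkcond [RHS]big_mkcond.
  apply: eq_bigr => n _; rewrite /v; case: ifPn => nF.
    by case: ifPn => nJ; rewrite ?TZ// scaler0.
  by case: ifPn => // /JF'; rewrite (negbTE nF).
exists v; split; last by move=> n nJ; rewrite /v memNset.
split.
  (* The coefficients of [y] against [v] are those of [T y] against [x]; the bounds combine [A], [B]
     with |y| / B <= |T y| <= |y| / A. *)
  apply/frameP; exists (A / B ^+ 2), (B / A ^+ 2); split.
  - by rewrite divr_gt0// exprn_gt0.
  - by rewrite divr_gt0// exprn_gt0.
  move=> y; have [s [cs /andP[h1 h2]]] := fb (T y).
  exists s; split; first by under eq_fun do rewrite coef_v.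
  apply/andP; split.
    apply: le_trans h1; rewrite mulrAC ler_pdivrMr ?exprn_gt0// -mulrA.
    rewrite ler_pM2l// mulrC !sqnormE -exprMn.
    by rewrite ler_sqr ?nnegrE ?mulr_ge0 ?nrm_ge0// ltW.
  apply: le_trans h2 _; rewrite mulrAC ler_pdivlMr ?exprn_gt0// -mulrA.
  rewrite ler_pM2l// mulrC !sqnormE -exprMn.
  by rewrite ler_sqr ?nnegrE ?mulr_ge0 ?nrm_ge0// ltW.
move=> y; apply: nrm_cvg; under eq_fun do rewrite sum_v.
have h : (fun N => A^-1 * nrm (frame_sum dot J x N y - S y)) @ \oo --> A^-1 * 0.
  by apply: cvgMr; exact: (frame_op_cvg fS y).
rewrite mulr0 in h; apply: (squeeze_cvgr _ (cvg_cst 0) h).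
apply: nearW => N; rewrite nrm_ge0 /= ler_pdivlMl//.
rewrite (_ : T _ - y = T (frame_sum dot J x N y - S y)); first exact: T_le.
by rewrite TB TS.
Qed.

End Redundancy.

Theorem theorem2p3 (R : realType) (H : completeNormedModType R[i])
    (dot : {dot H for Num.conj}) (hdot : inner_product_norm dot)
    (J : set nat) (hJ : index_set H J)
    (x : nat -> H) (hx : frame dot J x)
    (E : set nat) (hEJ : E `<=` J) (hE : finite_set E)
    (hmin : minimal_redundancy J E x) :
  exists v : nat -> H,
    dual_frame dot J x v /\ (forall n : nat, E n -> v n = 0).
Proof.
have [A [B [A0 B0 fb]]] := (frameP dot J x).1 hx.
have total := minimal_redundancy_total hdot hmin.
have /finite_seqP[s Es] := hE.
rewrite Es in total.
have [A1 A10 fb1] := frame_bounds_setD hdot A0 B0 fb total.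
have fr : frame dot (J `\` E) x by apply/frameP; exists A1, B; split; rewrite ?Es.
have [v [dv v0]] := frame_dual hdot (@subDsetl _ J E) fr.
(* An index of [E] lies outside [J \ E], where the dual vanishes. *)
by exists v; split=> // n En; apply: v0 => -[].
Qed.
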